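(* Let $M$ be a compact Riemannian manifold, $E$ a vector bundle over $M$, and $p\ge2$. Let $\nabla$ be a minimizer in $\mathcal W^p(E)$ of the Yang-Mills functional $\mathcal{YM}$, and suppose the norm $\|R^\nabla\|$ is constant almost everywhere. Then the same connection $\nabla$ is a minimizer of the $p$-Yang-Mills functional $\mathcal{YM}_p$ in $\mathcal W^p(E)$, and for any minimizer $\tilde\nabla$ of $\mathcal{YM}_p$ in $\mathcal W^p(E)$, the norm $\|R^{\tilde\nabla}\|$ is almost everywhere constant.
   Context: $E$ is equipped with a fiber metric. For a connection $\nabla$ on $E$, $R^\nabla$ is its curvature and, at $x\in M$, $\|R^\nabla\|^2=\sum_{i<j}\|R^\nabla_{e_i,e_j}\|^2$ for an orthonormal basis $\{e_i\}$ of $T_xM$, with the norm on $\mathrm{Hom}(E,E)$ given by $\langle S,U\rangle=\mathrm{trace}(S^T\circ U)$. The Yang-Mills functional is $\mathcal{YM}(\nabla)=\int_M\frac12\|R^\nabla\|^2dv$ and the $p$-Yang-Mills functional is $\mathcal{YM}_p(\nabla)=\int_M\frac1p\|R^\nabla\|^pdv$. $\mathcal L_1^p(E)$ denotes the Sobolev space of connections of $E$ which are $p$-integrable together with their first derivatives, and $\mathcal W^p(E)=\mathcal L_1^p(E)\cap\mathcal L_1^2(E)$ for $p\ge2$. A minimizer in $\mathcal W^p(E)$ of a functional is an element of $\mathcal W^p(E)$ at which the functional attains its infimum over $\mathcal W^p(E)$.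
   Formalization: The second conclusion (a.e. constant norm of every minimizer of YM_p) is stated only for p>2: at p=2 it fails, since on round S^4 conformal pullbacks of the standard instanton are YM minimizers with non-constant norm; the first conclusion keeps p≥2. *)

(* Defs.v *)
From HB Require Import structures.
From mathcomp Require Import all_boot all_order all_algebra.
From mathcomp Require Import all_classical all_reals all_analysis.
From mathcomp Require Import measurable_realfun.

Set Implicit Arguments.
Unset Strict Implicit.
Unset Printing Implicit Defensive.

Import Order.TTheory GRing.Theory Num.Theory.
Import numFieldNormedType.Exports.

Local Open Scope classical_set_scope.
Local Open Scope ring_scope.

Notation borel T := (g_sigma_algebraType (@open T)).

Section lebesgue_rV.
Variable R : realType.

Section row_vectors.
Context d (T : measurableType d).

Lemma measurable_rV n (f : T -> borel 'rV[R]_n) :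
  (forall j, measurable_fun setT (fun t => f t ord0 j : measurableTypeR R)) ->
  measurable_fun setT f.
Proof.
move=> mf; apply: (@measurability _ _ T (borel 'rV[R]_n) setT f (@open 'rV[R]_n)) => //.
move=> _ [U oU <-]; rewrite setTI.
pose box (q : 'rV[rat]_n) (k : nat) : set 'rV[R]_n :=
  [set v | forall j, `|ratr (q ord0 j) - v ord0 j| < k.+1%:R^-1].
pose F (i : 'rV[rat]_n * nat) : set T :=
  if `[< box i.1 i.2 `<=` U >] then f @^-1` box i.1 i.2 else set0.
have -> : f @^-1` U = \bigcup_i F i.
  apply/seteqP; split=> [t Uft|t [[q k] _]]; last first.
    by rewrite /F/=; case: asboolP => // sU /sU.
  have /nbhs_ballP[e/= e0 eU] : nbhs (f t : 'rV[R]_n) U by exact: open_nbhs_nbhs.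
  have [k] : exists k, 0 + k.+1%:R^-1 < e / 2 by apply: ltr_add_invr; rewrite divr_gt0.
  rewrite add0r => ke.
  have k0 : 0 < k.+1%:R^-1 :> R by rewrite invr_gt0.
  have hq j : exists q : rat, `|ratr q - (f t : 'rV[R]_n) ord0 j| < k.+1%:R^-1.
    have [|q] := @rat_in_itvoo R ((f t : 'rV[R]_n) ord0 j)
      ((f t : 'rV[R]_n) ord0 j + k.+1%:R^-1).
      by rewrite ltrDl.
    rewrite in_itv/= => /andP[h1 h2]; exists q.
    by rewrite gtr0_norm ?subr_gt0// ltrBlDl.
  have {}hq j := cid (hq j).
  exists (\row_j sval (hq j), k) => //.
  rewrite /F/=; case: asboolP => [_ j|[]].
    by rewrite mxE; case: (hq j).
  move=> v hv; apply: eU; split=> // i j; rewrite ord1.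
  have := hv j; rewrite mxE; case: (hq j) => q/= h1 h2.
  rewrite /ball/= -(subrK (ratr q) (f t ord0 j)) -addrA.
  rewrite (le_lt_trans (ler_normD _ _))// (splitr e) ltrD//.
    by rewrite distrC (lt_trans h1).
  exact: lt_trans ke.
apply: countable_bigcupT_measurable; first exact: countableP.
move=> [q k]; rewrite /F/=; case: ifP => _; last exact: measurable0.
have -> : f @^-1` box q k = \bigcap_(j in [set: 'I_n])
    ((fun t => f t ord0 j : measurableTypeR R) @^-1`
       ball (ratr (q ord0 j) : R) k.+1%:R^-1).
  by apply/seteqP; split=> [t h j _|t h j]; exact: h.
apply: fin_bigcap_measurable => // j _; rewrite -[X in measurable X]setTI.
by apply: mf => //; rewrite ball_itv; exact: measurable_itv.
Qed.

End row_vectors.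

Lemma measurable_coord n (j : 'I_n) :
  measurable_fun setT (fun v : borel 'rV[R]_n => v ord0 j : measurableTypeR R).
Proof.
apply: (@measurability _ _ _ (measurableTypeR R) _ _ (@RGenOpens.G R)); first exact: RGenOpens.measurableE.
move=> _ [_ [x [y ->]] <-]; rewrite setTI; apply: sub_sigma_algebra.
by apply: open_comp => // v _; exact: coord_continuous.
Qed.

Definition consv n (p : measurableTypeR R * borel 'rV[R]_n) :
    borel 'rV[R]_n.+1 :=
  \row_j oapp (fun k => (p.2 : 'rV[R]_n) ord0 k) (p.1 : R) (unlift ord0 j).

Definition unconsv n (v : borel 'rV[R]_n.+1) :
    measurableTypeR R * borel 'rV[R]_n :=
  (v ord0 ord0, \row_j v ord0 (lift ord0 j)).

Lemma consv0 n (p : measurableTypeR R * borel 'rV[R]_n) :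
  consv p ord0 ord0 = p.1.
Proof. by rewrite mxE unlift_none. Qed.

Lemma consvS n (p : measurableTypeR R * borel 'rV[R]_n) j :
  consv p ord0 (lift ord0 j) = p.2 ord0 j.
Proof. by rewrite mxE liftK. Qed.

Lemma consvK n : cancel (@consv n) (@unconsv n).
Proof.
move=> [t v]; rewrite /unconsv consv0; congr pair.
by apply/rowP => j; rewrite mxE consvS.
Qed.

Lemma measurable_consv n : measurable_fun setT (@consv n).
Proof.
apply: measurable_rV => j; case: (unliftP ord0 j) => [k|] ->.
  apply: (eq_measurable_fun ((fun v : borel 'rV[R]_n => v ord0 k) \o snd)).
    by move=> p _; rewrite consvS.
  by apply: measurableT_comp; [exact: measurable_coord|exact: measurable_snd].
apply: (eq_measurable_fun fst); last exact: measurable_fst.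
by move=> p _; rewrite consv0.
Qed.

Lemma measurable_unconsv n : measurable_fun setT (@unconsv n).
Proof.
apply/measurable_fun_pairP; split; first exact: measurable_coord.
apply: measurable_rV => j /=.
apply: (eq_measurable_fun (fun v : borel 'rV[R]_n.+1 => v ord0 (lift ord0 j))).
  by move=> v _; rewrite /= mxE.
exact: measurable_coord.
Qed.

Section cons_measure.
Local Open Scope ereal_scope.
Variables (n : nat) (m : {sigma_finite_measure set (borel 'rV[R]_n) -> \bar R}).

Definition cons_measure : set (borel 'rV[R]_n.+1) -> \bar R :=
  pushforward (@lebesgue_measure R \x m) (@consv n).

Let cons_measure0 : cons_measure set0 = 0.
Proof. by rewrite /cons_measure /pushforward preimage_set0 measure0. Qed.

Let cons_measure_ge0 A : 0 <= cons_measure A.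
Proof. exact: (@measure_ge0 _ _ _ (@lebesgue_measure R \x m)). Qed.

Let cons_measure_sigma_additive : semi_sigma_additive cons_measure.
Proof.
move=> F mF tF mUF; rewrite /cons_measure /pushforward preimage_bigcup.
have mc A : measurable A -> measurable (@consv n @^-1` A).
  by move=> mA; rewrite -[X in measurable X]setTI; exact: measurable_consv.
apply: (@measure_semi_sigma_additive _ _ _ (@lebesgue_measure R \x m)).
- by move=> i; exact: mc.
- apply/trivIsetP => i j _ _ ij; rewrite -preimage_setI.
  by move/trivIsetP : tF => /(_ _ _ _ _ ij) ->//; rewrite preimage_set0.
- by rewrite -preimage_bigcup; exact: mc.
Qed.

HB.instance Definition _ := isMeasure.Build _ _ _ cons_measure
  cons_measure0 cons_measure_ge0 cons_measure_sigma_additive.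

Let cons_measure_sigma_finite : sigma_finite setT cons_measure.
Proof.
have /sigma_finiteP[F [TF ndF Foo]] := sigma_finiteT (@lebesgue_measure R).
have /sigma_finiteP[G [TG ndG Goo]] := sigma_finiteT m.
exists (fun k => @unconsv n @^-1` (F k `*` G k)).
  rewrite -preimage_bigcup; apply/esym/seteqP; split=> // v _ /=.
  have [i _ Fi] : (\bigcup_i F i) (unconsv v).1 by rewrite -TF.
  have [j _ Gj] : (\bigcup_i G i) (unconsv v).2 by rewrite -TG.
  exists (maxn i j) => //; split.
    by move: Fi; exact/subsetPset/ndF/leq_maxl.
  by move: Gj; exact/subsetPset/ndG/leq_maxr.
move=> k; have [? ?] := Foo k; have [? ?] := Goo k; split.
  rewrite -[X in measurable X]setTI; apply: measurable_unconsv => //.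
  exact: measurableX.
rewrite /cons_measure /pushforward.
have -> : @consv n @^-1` (@unconsv n @^-1` (F k `*` G k)) = F k `*` G k.
  by rewrite -comp_preimage (_ : _ \o _ = id)//; apply/funext => p; exact: consvK.
by rewrite product_measure1E// lte_mul_pinfty// ge0_fin_numE.
Qed.

HB.instance Definition _ := Measure_isSigmaFinite.Build _ _ _ cons_measure
  cons_measure_sigma_finite.

End cons_measure.

Fixpoint lebesgue_rV (n : nat) :
    {sigma_finite_measure set (borel 'rV[R]_n) -> \bar R} :=
  match n with
  | 0 => @dirac _ (borel 'rV[R]_0) 0 R
  | n'.+1 => cons_measure (lebesgue_rV n')
  end.

Lemma lebesgue_rV_box n (a b : 'rV[R]_n) :
  (forall j, a ord0 j <= b ord0 j) ->
  lebesgue_rV n [set v : 'rV[R]_n | forall j, a ord0 j < v ord0 j <= b ord0 j] =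
  (\prod_j (b ord0 j - a ord0 j))%:E.
Proof.
elim: n a b => [|n IH] a b ab.
  by rewrite /= big_ord0 diracE mem_set//= => -[].
rewrite big_ord_recl EFinM /= /cons_measure /pushforward.
pose a' : 'rV[R]_n := \row_j a ord0 (lift ord0 j).
pose b' : 'rV[R]_n := \row_j b ord0 (lift ord0 j).
pose B' := [set v : 'rV[R]_n | forall j, a' ord0 j < v ord0 j <= b' ord0 j].
have -> : (@consv n) @^-1` [set v | forall j, a ord0 j < v ord0 j <= b ord0 j] =
    `]a ord0 ord0, b ord0 ord0]%classic `*` B'.
  apply/seteqP; split=> [p/= h|p [/= h0 h] j].
    split=> /= [|j]; first by have := h ord0; rewrite consv0 in_itv.
    by have := h (lift ord0 j); rewrite consvS !mxE.
  case: (unliftP ord0 j) => [k|] ->; first by rewrite consvS; have := h k; rewrite !mxE.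
  by rewrite consv0; move: h0; rewrite in_itv.
rewrite product_measure1E//; last first.
  have -> : B' = \bigcap_(j in [set: 'I_n])
      ((fun v : borel 'rV[R]_n => v ord0 j : measurableTypeR R) @^-1`
         `]a' ord0 j, b' ord0 j]%classic).
    apply/seteqP; split=> [v h j _|v h j].
      by rewrite /= in_itv; exact: h.
    by have := h j I; rewrite /= in_itv.
  apply: fin_bigcap_measurable => // j _; rewrite -[X in measurable X]setTI.
  exact: measurable_coord.
rewrite /B' IH => [|j]; last by rewrite !mxE.
congr (_ * _)%E; last by congr EFin; apply: eq_bigr => j _; rewrite !mxE.
have := @lebesgue_measure_itv R `]a ord0 ord0, b ord0 ord0].
rewrite /= lte_fin => ->.
by have := ab ord0; case: ltgtP => // ->; rewrite subrr.
Qed.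

End lebesgue_rV.

Section smooth.
Variables (R : realType) (n : nat).

Definition partial (a : 'I_n) (f : 'rV[R]_n -> R) : 'rV[R]_n -> R :=
  'D_(delta_mx ord0 a) f.

Fixpoint Ck (k : nat) (V : set 'rV[R]_n) (f : 'rV[R]_n -> R) : Prop :=
  (forall y, V y -> {for y, continuous f}) /\
  (if k is k'.+1 then
     forall a, (forall y, V y -> derivable f y (delta_mx ord0 a)) /\
               Ck k' V (partial a f)
   else True).

Definition smooth (V : set 'rV[R]_n) (f : 'rV[R]_n -> R) :=
  forall k, Ck k V f.

End smooth.

Section sobolev.
Variables (R : realType) (n : nat).
Local Notation leb := (lebesgue_rV R n).

Definition Lp_loc (p : R) (V : set 'rV[R]_n) (f : 'rV[R]_n -> R) :=
  measurable_fun (V : set (borel 'rV[R]_n)) (f : borel 'rV[R]_n -> R) /\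
  forall K, compact K -> K `<=` V ->
    (\int[leb]_(y in K) (`|f y| `^ p)%:E < +oo)%E.

Definition test_function (V : set 'rV[R]_n) (eta : 'rV[R]_n -> R) :=
  smooth setT eta /\
  exists2 K, compact K /\ K `<=` V & forall y, ~ K y -> eta y = 0.

Definition is_weak_partial (V : set 'rV[R]_n) (a : 'I_n)
    (f h : 'rV[R]_n -> R) :=
  [/\ Lp_loc 1 V f, Lp_loc 1 V h &
    forall eta, test_function V eta ->
      (\int[leb]_(y in V) (f y * partial a eta y)%:E =
       - \int[leb]_(y in V) (h y * eta y)%:E)%E].

(* weak derivatives are unique almost everywhere when they exist *)
Definition weak_partial (V : set 'rV[R]_n) (a : 'I_n) (f : 'rV[R]_n -> R) :
    'rV[R]_n -> R :=
  xget (fun=> 0) [set h | is_weak_partial V a f h].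

Definition W1p_loc (p : R) (V : set 'rV[R]_n) (f : 'rV[R]_n -> R) :=
  Lp_loc p V f /\
  forall a, exists2 h, is_weak_partial V a f h & Lp_loc p V h.

End sobolev.

(* Manifolds are second countable, so a smooth structure is always given by a
   sequence of charts, over whose domains a given vector bundle may moreover be
   assumed trivial; [dom i] may be empty *)
Record smooth_manifold (R : realType) (n : nat) (M : ptopologicalType) :=
  SmoothManifold {
    dom : nat -> set M ;
    chart : nat -> M -> 'rV[R]_n ;
    param : nat -> 'rV[R]_n -> M ;
    manifold_hausdorff : hausdorff_space M ;
    dom_open : forall i, open (dom i) ;
    dom_cover : \bigcup_i dom i = setT ;
    chart_open : forall i, open (chart i @` dom i) ;
    chartK : forall i x, dom i x -> param i (chart i x) = x ;
    chart_continuous : forall i, {within dom i, continuous (chart i)} ;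
    param_continuous :
      forall i, {within chart i @` dom i, continuous (param i)} ;
    transition_smooth : forall i j (k : 'I_n),
      smooth (chart i @` (dom i `&` dom j))
             (fun y => chart j (param i y) ord0 k) }.

Section manifold.
Variables (R : realType) (n : nat) (M : ptopologicalType).
Variable X : smooth_manifold R n M.

Definition codom_chart (i : nat) : set 'rV[R]_n := chart X i @` dom X i.

Definition overlap (i j : nat) : set 'rV[R]_n :=
  chart X i @` (dom X i `&` dom X j).

Definition transition (i j : nat) : 'rV[R]_n -> 'rV[R]_n :=
  chart X j \o param X i.

(* [metric i y] is the Gram matrix of the coordinate vector fields of chart i
   at the point of coordinates y; row a of the library's Jacobian holds the
   partial derivatives with respect to the a-th variable *)
Record riemannian_metric := RiemannianMetric {
  metric : nat -> 'rV[R]_n -> 'M[R]_n ;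
  metric_smooth : forall i a b,
    smooth (codom_chart i) (fun y => metric i y a b) ;
  metric_sym : forall i y, codom_chart i y -> (metric i y)^T = metric i y ;
  metric_pos : forall i y, codom_chart i y -> forall u : 'rV[R]_n, u != 0 ->
    0 < (u *m metric i y *m u^T) ord0 ord0 ;
  metric_transition : forall i j y, overlap i j y ->
    metric i y = 'J (transition i j) y *m metric j (transition i j y) *m
                 ('J (transition i j) y)^T }.

(* these equations determine the measure, as the charts form a countable open
   cover *)
Definition is_riemannian_volume (g : riemannian_metric)
    (vol : {measure set (borel M) -> \bar R}) :=
  forall i (B : set (borel M)), measurable B -> B `<=` dom X i ->
    vol B = (\int[lebesgue_rV R n]_(y in chart X i @` B)
               (Num.sqrt (\det (metric g i y)))%:E)%E.

Record vector_bundle (r : nat) := VectorBundle {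
  fibre : M -> vectType R ;
  frame : nat -> forall x, r.-tuple (fibre x) ;
  frame_basis : forall i x, dom X i x -> basis_of fullv (frame i x) ;
  frame_smooth : forall i j (s t : 'I_r),
    smooth (overlap i j)
      (fun y => coord (frame i (param X i y)) s (frame j (param X i y))`_t) }.

End manifold.

Section bundle.
Variables (R : realType) (n r : nat) (M : ptopologicalType).
Variables (X : smooth_manifold R n M) (E : vector_bundle X r).

Record fibre_metric := FibreMetric {
  ip : forall x, fibre E x -> fibre E x -> R ;
  ip_linear : forall x (c : R) (u v w : fibre E x),
    ip (c *: u + v) w = c * ip u w + ip v w ;
  ip_sym : forall x (u v : fibre E x), ip u v = ip v u ;
  ip_pos : forall x (u : fibre E x), u != 0 -> 0 < ip u u ;
  ip_smooth : forall i (s t : 'I_r),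
    smooth (codom_chart X i) (fun y =>
      ip (frame E i (param X i y))`_s (frame E i (param X i y))`_t) }.

Definition gram (h : fibre_metric) (i : nat) (y : 'rV[R]_n) : 'M[R]_r :=
  \matrix_(s, t) ip h (frame E i (param X i y))`_s (frame E i (param X i y))`_t.

(* the frames satisfy (frame j)_t = \sum_s gauge_st (frame i)_s *)
Definition gauge (i j : nat) (y : 'rV[R]_n) : 'M[R]_r :=
  \matrix_(s, t)
    coord (frame E i (param X i y)) s (frame E j (param X i y))`_t.

(* A connection is written d + A in each frame: with e the row of sections
   forming the frame of index i and d_a the a-th coordinate vector field of
   chart i, nabla_(d_a) e = e *m form i a. As the coefficients are only
   measurable, the transformation rule under change of chart and frame holds
   almost everywhere *)
Record connection := Connection {
  form : nat -> 'I_n -> 'rV[R]_n -> 'M[R]_r ;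
  form_transition : forall i j, {ae lebesgue_rV R n, forall y, overlap X i j y ->
    forall a,
      \sum_b 'J (transition X i j) y a b *: form j b (transition X i j y) =
      invmx (gauge i j y) *m form i a y *m gauge i j y +
      invmx (gauge i j y) *m
        (\matrix_(s, t) partial a (fun z => gauge i j z s t) y)} }.

(* On a compact M, p-integrability of a connection and of its first derivatives
   amounts to local p-integrability of its coefficients and of their weak
   derivatives *)
Definition L1p (p : R) : set connection :=
  [set D | forall i a s t,
     W1p_loc p (codom_chart X i) (fun y => form D i a y s t)].

Definition Wp (p : R) : set connection := L1p p `&` L1p 2.

(* matrix, in the frame of index i, of the curvature on the coordinate vector
   fields of indices a and b *)
Definition curv_coef (D : connection) (i : nat) (a b : 'I_n) (y : 'rV[R]_n) :
    'M[R]_r :=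
  let d k l : 'M[R]_r :=
    \matrix_(s, t)
      weak_partial (codom_chart X i) k (fun z => form D i l z s t) y in
  d a b - d b a + form D i a y *m form D i b y - form D i b y *m form D i a y.

Variables (g : riemannian_metric X) (h : fibre_metric).

(* rows: the coordinates of the vectors of an orthonormal basis *)
Definition orthonormal_basis (i : nat) (y : 'rV[R]_n) : 'M[R]_n :=
  xget 1%:M [set P : 'M[R]_n | P *m metric g i y *m P^T = 1%:M].

Definition curv (D : connection) (i : nat) (y u v : 'rV[R]_n) : 'M[R]_r :=
  \sum_a \sum_b (u ord0 a * v ord0 b) *: curv_coef D i a b y.

(* matrix of the adjoint for the fibre metric *)
Definition adjoint (i : nat) (y : 'rV[R]_n) (S : 'M[R]_r) : 'M[R]_r :=
  invmx (gram h i y) *m S^T *m gram h i y.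

Definition hom_norm2 (i : nat) (y : 'rV[R]_n) (S : 'M[R]_r) : R :=
  \tr (adjoint i y S *m S).

Definition first_chart (x : M) : nat :=
  xget 0%N [set i | dom X i x /\ forall j, dom X j x -> (i <= j)%N].

(* almost everywhere, the value does not depend on the chart, frame and
   orthonormal basis used *)
Definition curv_norm (D : connection) (x : M) : R :=
  let i := first_chart x in
  let y := chart X i x in
  let e k := row k (orthonormal_basis i y) in
  Num.sqrt (\sum_(k < n) \sum_(l < n | (k < l)%N)
              hom_norm2 i y (curv D i y (e k) (e l))).

Variable vol : {measure set (borel M) -> \bar R}.

Definition YM (D : connection) : \bar R :=
  (\int[vol]_x (2^-1 * curv_norm D x ^+ 2)%:E)%E.

Definition YMp (p : R) (D : connection) : \bar R :=
  (\int[vol]_x (p^-1 * curv_norm D x `^ p)%:E)%E.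

Definition curv_norm_ae_constant (D : connection) :=
  exists c : R, {ae vol, forall x, curv_norm D x = c}.

End bundle.

Definition minimizer (R : realType) (T : Type) (S : set T) (F : T -> \bar R)
    (D : T) :=
  S D /\ F D = ereal_inf (F @` S).

Arguments L1p {R n r M X} E p.
Arguments Wp {R n r M X} E p.

(* Main.v *)
Require Import Defs.
From mathcomp Require Import all_boot all_order all_algebra.
From mathcomp Require Import all_classical all_reals all_analysis.
From mathcomp Require Import measurable_realfun ring lra.

(** Write f for the curvature norm of a competitor, c for the constant value of
the curvature norm of the given Yang-Mills minimizer, and V for the volume of
the manifold.  The tangent line at c^2 to the convex function t |-> t^(p/2)
gives the pointwise inequality
  p c^(p-2) f^2 <= 2 f^p + (p-2) c^p,
which is strict off f = c as soon as p > 2 ([young_le], [young_leif]).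
Minimality for the Yang-Mills functional says that the integral of f^2 is at
least c^2 V; integrating the pointwise inequality turns this into: the integral
of f^p is at least c^p V ([integral_powR_ge]).  The right-hand side is the value
of the integral at the given connection, which is therefore a minimizer of the
p-Yang-Mills functional.  If another connection reaches the same value, then the
integrals of the two sides of the pointwise inequality agree, so the sides agree
almost everywhere, and f = c almost everywhere ([integral_powR_eq]).

This argument rests on two facts about the geometry.

The volume V is finite ([volume_fin]).  A point has a neighbourhood that a chart
sends onto a ball on which the density sqrt (det g) is bounded, and by
compactness finitely many of these neighbourhoods cover the manifold.

The curvature norm is a measurable function ([measurable_curv_norm]).  The
integral of a function that is not measurable is only a lower integral, which
would not control the function from above, so the equality case does need this.
The difficulty is that the curvature norm is computed in an orthonormal basis
that is chosen arbitrarily at each point.  However, if the rows of P form such a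
basis, that is P g P^T = 1, then P^T P = g^-1, and the sum over the pairs of
basis vectors becomes half a contraction of the coordinates of the curvature
with two copies of g^-1 ([sum_orthonormal]).  This expression is measurable:
the coefficients of g and of the fibre metric are continuous, and those of the
connection, as well as their weak derivatives, are measurable by the definition
of the Sobolev space.  That an orthonormal basis exists at each point is the
Gram-Schmidt process ([posdef_congr1]). *)

Set Implicit Arguments.
Unset Strict Implicit.
Unset Printing Implicit Defensive.

Import Order.TTheory GRing.Theory Num.Theory.
Import numFieldNormedType.Exports.

Local Open Scope classical_set_scope.
Local Open Scope ring_scope.

(** * A sharp tangent line inequality *)

Section tangent_line.
Variable R : realType.
Implicit Types u s c w p : R.

(** Young's inequality for the product u * 1, with exponents s and
    s / (s - 1). *)
Lemma bernoulli_powR u s : 0 <= u -> 1 < s -> 1 + s * (u - 1) <= u `^ s.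
Proof.
move=> u0 s1; have s0 : 0 < s by lra.
have q0 : 0 < (s - 1) / s by rewrite divr_gt0//; lra.
have := @conjugate_powR R u 1 s ((s - 1) / s)^-1 u0 ler01 s0.
rewrite invr_gt0 invrK powR1 mulr1 => /(_ q0).
have -> : s^-1 + (s - 1) / s = 1 by field; lra.
move=> /(_ erefl); rewrite mul1r => h.
have : s * u <= s * (u `^ s / s + (s - 1) / s) by rewrite ler_pM2l.
have -> : s * (u `^ s / s + (s - 1) / s) = u `^ s + (s - 1) by field; lra.
lra.
Qed.

(** Strictness comes from the weak inequality at w = sqrt u: when the tangent
    line is nonnegative at w, its square is a lower bound for u^s that exceeds
    the tangent line at u by s (s - 1) (w - 1)^2. *)
Lemma bernoulli_powR_lt u s : 0 <= u -> 1 < s -> u != 1 ->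
  1 + s * (u - 1) < u `^ s.
Proof.
move=> u0 s1 u1; set w := Num.sqrt u.
have w0 : 0 <= w by exact: sqrtr_ge0.
have uE : u = w ^+ 2 by rewrite sqr_sqrtr.
have w1 : w != 1 by apply: contra u1 => /eqP w1; rewrite uE w1 expr1n.
have -> : u `^ s = (w `^ s) ^+ 2.
  by rewrite uE !expr2 powRM.
have h := bernoulli_powR w0 s1.
have w2 : 0 < (w - 1) ^+ 2 by rewrite exprn_even_gt0//= subr_eq0.
rewrite uE; have [t0|t0] := leP 0 (1 + s * (w - 1)).
  have : (1 + s * (w - 1)) ^+ 2 <= (w `^ s) ^+ 2
    by rewrite ler_pXn2r// nnegrE powR_ge0.
  apply: lt_le_trans; rewrite -subr_gt0.
  have -> : (1 + s * (w - 1)) ^+ 2 - (1 + s * (w ^+ 2 - 1)) =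
    s * (s - 1) * (w - 1) ^+ 2 by ring.
  by rewrite mulr_gt0// mulr_gt0//; lra.
(* the tangent line is negative at w, hence also at u = w ^+ 2 *)
apply: lt_le_trans (sqr_ge0 _).
have : s * (w - 1) * (w + 1) < -1 * (w + 1) by rewrite ltr_pM2r//; lra.
rewrite -mulrA -subr_sqr expr1n.
lra.
Qed.

(** For c > 0, Bernoulli's inequality for u = (w / c)^2 and s = p / 2. *)
Lemma young_leif c w p : 0 <= c -> 0 <= w -> 2 < p ->
  p * c `^ (p - 2) * w ^+ 2 <= 2 * w `^ p + (p - 2) * c `^ p ?= iff (w == c).
Proof.
move=> c0 w0 p2; have p0 : p != 0 by lra.
have [->|cn0] := eqVneq c 0.
  rewrite !powR0//; last by lra.
  rewrite !mulr0 mul0r addr0; apply/leifP; case: eqVneq => [->|wn0].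
    by rewrite powR0// mulr0.
  by rewrite mulr_gt0// powR_gt0// lt_def wn0.
have {cn0} c0' : 0 < c by rewrite lt_def cn0.
have cE : c `^ (p - 2) * c ^+ 2 = c `^ p.
  rewrite -(@powR_mulrn _ c 2)// -powRD; first by congr powR; lra.
  by rewrite (gt_eqF c0') implybT.
set u := (w / c) ^+ 2.
have u0 : 0 <= u by exact: sqr_ge0.
have wE : w ^+ 2 = u * c ^+ 2 by rewrite /u -exprMn divfK// gt_eqF.
have uE : w `^ p = u `^ (p / 2) * c `^ p.
  rewrite -{1}(divfK (lt0r_neq0 c0') w).
  rewrite powRM//; last by rewrite divr_ge0.
  congr (_ * _); rewrite /u -powR_mulrn ?divr_ge0// -powRrM; congr powR.
  by rewrite mulrC divfK.
have cp0 : 0 < c `^ p by rewrite powR_gt0.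
rewrite wE uE mulrACA cE.
have -> : 2 * (u `^ (p / 2) * c `^ p) + (p - 2) * c `^ p =
  (2 * u `^ (p / 2) + (p - 2)) * c `^ p by ring.
apply/leifP; case: eqVneq => [wc|wc].
  by rewrite /u wc (divff (lt0r_neq0 c0')) expr1n powR1; apply/eqP; ring.
have u1 : u != 1.
  rewrite /u sqrp_eq1 ?divr_ge0//; apply: contra wc => /eqP wc.
  by rewrite -(divfK (lt0r_neq0 c0') w) wc mul1r.
rewrite ltr_pM2r//.
have := bernoulli_powR_lt u0 _ u1 => /(_ (p / 2)).
have h : 1 < p / 2 by lra.
move=> /(_ h); lra.
Qed.


Lemma young_le c w p : 0 <= c -> 0 <= w -> 2 <= p ->
  p * c `^ (p - 2) * w ^+ 2 <= 2 * w `^ p + (p - 2) * c `^ p.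
Proof.
move=> c0 w0; rewrite le_eqVlt => /predU1P[<-|p2].
  by rewrite subrr powRr0 mulr1 mul0r addr0 powR_mulrn.
by rewrite young_leif.
Qed.

End tangent_line.

(** * Comparing the integrals of squares and of p-th powers *)

Section integral_comparison.
Context (R : realType) d (T : measurableType d).
Variable mu : {measure set T -> \bar R}.
Local Open Scope ereal_scope.

Lemma le_integral_ae_eq (f g : T -> R) :
  measurable_fun setT f -> measurable_fun setT g ->
  (forall x, 0 <= f x <= g x)%R ->
  \int[mu]_x (g x)%:E <= \int[mu]_x (f x)%:E -> \int[mu]_x (f x)%:E < +oo ->
  {ae mu, forall x, f x = g x}.
Proof.
move=> mf mg fg gf foo.
have f0 x : (0 <= f x)%R by case/andP: (fg x).
have fleg x : (f x <= g x)%R by case/andP: (fg x).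
have mh : measurable_fun setT (g \- f)%R by exact: measurable_funB.
have : \int[mu]_x (g x)%:E = \int[mu]_x (f x)%:E + \int[mu]_x ((g \- f)%R x)%:E.
  rewrite -ge0_integralD//.
  - by apply: eq_integral => x _; rewrite -EFinD/= addrC subrK.
  - by move=> x _; rewrite lee_fin.
  - exact/measurable_EFinP.
  - by move=> x _; rewrite lee_fin subr_ge0.
  - exact/measurable_EFinP.
move=> E; move: gf; rewrite E -[leRHS]adde0.
rewrite leeD2lE; last first.
  by rewrite ge0_fin_numE//; apply: integral_ge0 => x _; rewrite lee_fin.
move=> h0.
have : \int[mu]_x `|((g \- f)%R x)%:E| = 0.
  apply/eqP; rewrite eq_le integral_ge0// andbT.
  rewrite (eq_integral (fun x => ((g \- f)%R x)%:E))//.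
  by move=> x _; rewrite gee0_abs// lee_fin subr_ge0.
move/(ae_eq_integral_abs mu measurableT _).1 => /(_ _)[|N [mN N0 hN]].
  exact/measurable_EFinP.
exists N; split=> // x hx; apply: hN => /= h; apply: hx.
by have /= [] := h I => /eqP; rewrite subr_eq0 => /eqP.
Qed.

Variables (f : T -> R) (c p : R).
Hypotheses (mf : measurable_fun setT f) (f0 : forall x, (0 <= f x)%R).
Hypotheses (c0 : (0 <= c)%R) (muoo : mu setT < +oo).
Hypothesis cf : (c ^+ 2)%:E * mu setT <= \int[mu]_x (f x ^+ 2)%:E.

Let mfp : measurable_fun setT (fun x => f x `^ p)%R.
Proof. by apply: (measurableT_comp (measurable_powR p)). Qed.

Let mf2 : measurable_fun setT (fun x => f x ^+ 2)%R.
Proof. exact: measurable_funX. Qed.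

Let young_lower : (2 <= p)%R ->
  (p * c `^ p)%:E * mu setT <= \int[mu]_x (p * c `^ (p - 2) * f x ^+ 2)%:E.
Proof.
move=> p2.
have k0 : (0 <= p * c `^ (p - 2))%R by rewrite mulr_ge0 ?powR_ge0//; lra.
under eq_integral do rewrite EFinM.
rewrite ge0_integralZl_EFin//; last 2 first.
- by move=> x _; rewrite lee_fin sqr_ge0.
- exact/measurable_EFinP.
apply: le_trans (lee_wpmul2l _ cf); last by rewrite lee_fin.
rewrite muleA -EFinM -mulrA -[X in (c `^ _ * X)%R]powR_mulrn//.
rewrite -powRD ?subrK//.
by apply/implyP => /eqP; lra.
Qed.

Let young_upper : (2 <= p)%R ->
  \int[mu]_x (2 * f x `^ p + (p - 2) * c `^ p)%:E =
  2%:E * \int[mu]_x (f x `^ p)%:E + ((p - 2) * c `^ p)%:E * mu setT.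
Proof.
move=> p2.
have k0 : (0 <= (p - 2) * c `^ p)%R by rewrite mulr_ge0 ?powR_ge0//; lra.
under eq_integral do rewrite EFinD EFinM.
rewrite ge0_integralD//.
- rewrite ge0_integralZl_EFin//.
  + by rewrite integral_cst.
  + by move=> x _; rewrite lee_fin powR_ge0.
  + exact/measurable_EFinP.
- by move=> x _; rewrite -EFinM lee_fin mulr_ge0// powR_ge0.
- by apply/measurable_EFinP; exact: measurable_funM.
Qed.

(** The constant terms (p - 2) c^p V on both sides cancel because the measure is
    finite. *)
Lemma integral_powR_ge : (2 <= p)%R ->
  (c `^ p)%:E * mu setT <= \int[mu]_x (f x `^ p)%:E.
Proof.
move=> p2.
have V : mu setT \is a fin_num by rewrite ge0_fin_numE.
have := young_lower p2.
have : \int[mu]_x (p * c `^ (p - 2) * f x ^+ 2)%:E <=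
    \int[mu]_x (2 * f x `^ p + (p - 2) * c `^ p)%:E.
  apply: ge0_le_integral => //.
  - move=> x _; rewrite lee_fin mulr_ge0 ?sqr_ge0// mulr_ge0 ?powR_ge0//; lra.
  - by apply/measurable_EFinP; exact: measurable_funM.
  - apply/measurable_EFinP; apply: measurable_funD => //.
    exact: measurable_funM.
  - by move=> x _; rewrite lee_fin young_le.
rewrite young_upper// => /[swap] /le_trans /[apply].
have -> : (p * c `^ p = 2 * c `^ p + (p - 2) * c `^ p)%R by ring.
rewrite EFinD muleDl//.
rewrite leeD2rE; last by rewrite fin_numM.
by rewrite EFinM -muleA lee_pmul2l// lte_fin.
Qed.

(** The integrals of the two sides of [young_le] coincide here. *)
Lemma integral_powR_eq : (2 < p)%R ->
  \int[mu]_x (f x `^ p)%:E <= (c `^ p)%:E * mu setT ->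
  {ae mu, forall x, f x = c}.
Proof.
move=> p2 fc.
have p2' : (2 <= p)%R := ltW p2.
have V : mu setT \is a fin_num by rewrite ge0_fin_numE.
have Boo : \int[mu]_x (2 * f x `^ p + (p - 2) * c `^ p)%:E <=
    (p * c `^ p)%:E * mu setT.
  rewrite young_upper//.
  have -> : (p * c `^ p = 2 * c `^ p + (p - 2) * c `^ p)%R by ring.
  rewrite [in leRHS]EFinD [leRHS]muleDl//.
  by apply: leeD => //; rewrite EFinM -muleA; exact: lee_wpmul2l.
have AB x : (0 <= p * c `^ (p - 2) * f x ^+ 2 <=
              2 * f x `^ p + (p - 2) * c `^ p)%R.
  rewrite young_le// andbT mulr_ge0 ?sqr_ge0// mulr_ge0 ?powR_ge0//; lra.
have mA : measurable_fun setT (fun x => p * c `^ (p - 2) * f x ^+ 2)%R.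
  exact: measurable_funM.
have mB : measurable_fun setT (fun x => 2 * f x `^ p + (p - 2) * c `^ p)%R.
  by apply: measurable_funD => //; exact: measurable_funM.
have := le_integral_ae_eq mA mB AB (le_trans Boo (young_lower p2')).
case.
  apply: le_lt_trans (le_trans _ Boo) _.
    apply: ge0_le_integral => //.
    - by move=> x _; rewrite lee_fin; case/andP: (AB x).
    - exact/measurable_EFinP.
    - exact/measurable_EFinP.
    - by move=> x _; rewrite lee_fin; case/andP: (AB x).
  rewrite -ge0_fin_numE ?fin_numM// mule_ge0// lee_fin mulr_ge0 ?powR_ge0//; lra.
move=> N [mN N0 hN]; exists N; split => // x hx; apply: hN => /= h; apply: hx.
by apply/eqP; rewrite -(young_leif c0 (f0 x) p2).2 h.
Qed.

End integral_comparison.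


(** * Orthonormal bases for a positive definite matrix *)

Definition sym_posdef (R : realType) n (G : 'M[R]_n) : Prop :=
  G^T = G /\ forall u : 'rV[R]_n, u != 0 -> 0 < (u *m G *m u^T) ord0 ord0.

(** One step of the Gram-Schmidt process clears the first row and column of G by
    the unipotent matrix L; what is left is the Schur complement S, which is
    again positive definite, and the induction continues with it. *)
Lemma posdef_congr1 (R : realType) n (G : 'M[R]_n) : sym_posdef G ->
  exists P : 'M[R]_n, P *m G *m P^T = 1%:M.
Proof.
elim: n G => [|n IH] G; first by exists 1%:M; apply/matrixP => -[].
rewrite -[n.+1]/(1 + n)%N in G *.
move=> [Gsym Gpos].
set a := G ord0 ord0.
have a0 : 0 < a.
  have := Gpos (delta_mx 0 0); rewrite -rowE.
  rewrite trmx_delta -colE !mxE; apply.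
  apply/eqP => /matrixP /(_ 0 0); rewrite !mxE eqxx => /eqP.
  by rewrite oner_eq0.
pose b := ursubmx G. pose d := drsubmx G.
have GE : G = block_mx a%:M b b^T d.
  rewrite -[LHS]submxK /b /d trmx_ursub Gsym; congr block_mx.
  apply/matrixP => i j; rewrite !ord1 !mxE eqxx mulr1n.
  by congr (G _ _); apply/val_inj.
pose S := d - a^-1 *: (b^T *m b).
pose L : 'M[R]_(1 + n) := block_mx 1%:M 0 (- a^-1 *: b^T) 1%:M.
have LGL : L *m G *m L^T = block_mx a%:M 0 0 S.
  rewrite GE /L tr_block_mx !mulmx_block !(trmx0, trmx1, mul1mx, mulmx1).
  rewrite !(mul0mx, mulmx0, addr0, add0r).
  rewrite linearZ /= trmxK.
  have aE : a%:M *m (- a^-1 *: b) = - b.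
    by rewrite mul_scalar_mx scalerA mulrN divff ?gt_eqF// scaleN1r.
  have aE' : (- a^-1 *: b^T) *m a%:M = - b^T.
    by rewrite mul_mx_scalar scalerA mulrN divff ?gt_eqF// scaleN1r.
  rewrite aE aE' !addNr mul0mx add0r /S -scalemxAl addrC scaleNr.
  congr block_mx.
have [P0 P0E] : exists P0 : 'M[R]_n, P0 *m S *m P0^T = 1%:M.
  apply: IH; split.
    rewrite /S linearB /= linearZ /= trmx_mul trmxK; congr (_ - _).
    by rewrite /d trmx_drsub Gsym.
  move=> u u0.
  have vE : row_mx (0 : 'rV_1) u *m block_mx (a%:M : 'M[R]_1) 0 0 S =
      row_mx 0 (u *m S).
    by rewrite mul_row_block !mul0mx !mulmx0 !add0r.
  have := Gpos (row_mx 0 u *m L).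
  rewrite trmx_mul !mulmxA -(mulmxA _ L) -(mulmxA _ (L *m G)) LGL vE.
  rewrite tr_row_mx trmx0 (mul_row_col 0 (u *m S)) mulmx0 add0r; apply.
  apply: contra u0 => /eqP; rewrite mul_row_block !mul0mx !mulmx1 !add0r.
  by rewrite -(row_mx0) => /eq_row_mx [_ ->].
exists (block_mx (Num.sqrt a)^-1%:M 0 0 P0 *m L).
rewrite trmx_mul !mulmxA -(mulmxA _ L) -(mulmxA _ (L *m G)) LGL.
rewrite tr_block_mx !mulmx_block !(trmx0, mul0mx, mulmx0, addr0, add0r) P0E.
rewrite tr_scalar_mx -!scalar_mxM (_ : _ * _ * _ = 1) ?scalar_mx_block//.
have sa : Num.sqrt a != 0 by rewrite gt_eqF// sqrtr_gt0.
by rewrite -{2}(sqr_sqrtr (ltW a0)); field.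
Qed.

Lemma congr1_inv (R : realType) n (P G : 'M[R]_n) : P *m G *m P^T = 1%:M ->
  P^T *m P = invmx G.
Proof.
move=> PGP.
have PG : P^T *m P *m G = 1%:M.
  by rewrite -mulmxA; apply: mulmx1C.
have [_ uG] := mulmx1_unit PG.
by rewrite -[LHS]mulmx1 -(mulmxV uG) mulmxA PG mul1mx.
Qed.

(** * The squared norm of a 2-form in an orthonormal basis *)

Section two_form_norm.
Variables (R : realType) (r : nat).

(** For W the inverse of the Gram matrix V of a metric on the fibre, this is the
    scalar product trace (S^* o U) of endomorphisms. *)
Definition trform (W V S U : 'M[R]_r) : R := \tr (W *m S^T *m V *m U).

Lemma trform_sum (I : finType) (W V : 'M[R]_r) (K : I -> R) (F : I -> 'M[R]_r) :
  trform W V (\sum_i K i *: F i) (\sum_i K i *: F i) =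
  \sum_i \sum_j K i * K j * trform W V (F i) (F j).
Proof.
rewrite /trform (linear_sum (@trmx R r r)) [W *m _]mulmx_sumr [_ *m V]mulmx_suml.
rewrite [X in \tr X]mulmx_suml linear_sum.
apply: eq_bigr => i _; rewrite mulmx_sumr linear_sum; apply: eq_bigr => j _.
rewrite /=; have -> : (K i *: F i)^T = K i *: (F i)^T.
  by apply/matrixP => s t; rewrite !mxE.
by rewrite -!scalemxAr -!scalemxAl !mxtraceZ mulrA [K i * K j]mulrC.
Qed.

Lemma sum_upper_triangle n (X : 'I_n -> 'I_n -> R) :
  (forall k l, X k l = X l k) -> (forall k, X k k = 0) ->
  \sum_(k < n) \sum_(l < n | (k < l)%N) X k l = 2^-1 * \sum_k \sum_l X k l.
Proof.
move=> Xsym X0.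
have H : \sum_k \sum_l X k l = 2 * \sum_(k < n) \sum_(l < n | (k < l)%N) X k l.
  rewrite (eq_bigr (fun k : 'I_n =>
    \sum_(l < n | (k < l)%N) X k l + \sum_(l < n | (l < k)%N) X k l)); last first.
    move=> k _; rewrite (bigID (fun l : 'I_n => (k < l)%N))/=; congr (_ + _).
    rewrite (bigD1 k) ?ltnn//= X0 add0r; apply: eq_bigl => l.
    by rewrite -leqNgt ltn_neqAle andbC.
  rewrite big_split/= mulr2n mulrDl mul1r; congr (_ + _).
  rewrite (exchange_big_dep xpredT)//=; apply: eq_bigr => k _.
  by apply: eq_bigr => l _.
by rewrite H mulrA mulVf ?mul1r// pnatr_eq0.
Qed.

(** C k l is the value of the 2-form F on the k-th and l-th rows of P.  The sum
    over k < l is half the sum over all pairs, and summing the squares over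
    pairs of rows of P contracts the coordinates of F with two copies of
    P^T P = G^-1. *)
Lemma sum_orthonormal n (W V : 'M[R]_r) (G P : 'M[R]_n)
    (F : 'I_n -> 'I_n -> 'M[R]_r) :
  P *m G *m P^T = 1%:M -> (forall a b, F b a = - F a b) ->
  let C k l := \sum_a \sum_b (P k a * P l b) *: F a b in
  \sum_(k < n) \sum_(l < n | (k < l)%N) trform W V (C k l) (C k l) =
  2^-1 * \sum_(i : 'I_n * 'I_n) \sum_(j : 'I_n * 'I_n)
    invmx G i.1 j.1 * invmx G i.2 j.2 * trform W V (F i.1 i.2) (F j.1 j.2).
Proof.
move=> PGP Fanti C.
have Canti k l : C l k = - C k l.
  rewrite /C exchange_big/= -sumrN; apply: eq_bigr => a _.
  by rewrite -sumrN; apply: eq_bigr => b _; rewrite Fanti scalerN mulrC.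
have trN S : trform W V (- S) (- S) = trform W V S S.
  rewrite /trform (_ : (- S)^T = - S^T); last by apply/matrixP => i j; rewrite !mxE.
  by rewrite !(mulmxN, mulNmx) opprK.
rewrite (@sum_upper_triangle _ (fun k l => trform W V (C k l) (C k l))); last 2 first.
- by move=> k l; rewrite Canti trN.
- move=> k; have -> : C k k = 0.
    have : C k k + C k k = 0 by rewrite {1}Canti addNr.
    rewrite -mulr2n => /eqP; rewrite -scaler_nat scaler_eq0 pnatr_eq0/=.
    by move/eqP.
  by rewrite /trform mulmx0 linear0.
congr (_ * _); rewrite pair_big/=.
have CE j : C j.1 j.2 =
    \sum_(i : 'I_n * 'I_n) (P j.1 i.1 * P j.2 i.2) *: F i.1 i.2.
  by rewrite /C pair_big.
under eq_bigr do rewrite CE trform_sum.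
rewrite exchange_big/=; apply: eq_bigr => i _.
rewrite exchange_big/=; apply: eq_bigr => j _.
rewrite -mulr_suml; congr (_ * _).
rewrite -(congr1_inv PGP) !mxE big_distrlr pair_big/=.
by apply: eq_bigr => k _; rewrite !mxE; ring.
Qed.

End two_form_norm.

(** * Measurable matrix-valued functions *)

Section mxmeasurable.
Context d (T : measurableType d) (R : realType) (D : set T).
Hypothesis mD : measurable D.

Definition mxmeasurable m n (A : T -> 'M[R]_(m, n)) :=
  forall i j, measurable_fun D (fun t => A t i j).

Lemma mxmeasurableT m n (A : T -> 'M[R]_(m, n)) :
  mxmeasurable A -> mxmeasurable (fun t => (A t)^T).
Proof.
by move=> mA i j; apply: eq_measurable_fun (mA j i) => t _; rewrite mxE.
Qed.

Lemma mxmeasurableM m n p (A : T -> 'M[R]_(m, n)) (B : T -> 'M[R]_(n, p)) :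
  mxmeasurable A -> mxmeasurable B -> mxmeasurable (fun t => A t *m B t).
Proof.
move=> mA mB i j.
apply: (eq_measurable_fun (fun t => \sum_k A t i k * B t k j)).
  by move=> t _; rewrite mxE.
by apply: measurable_sum => k; exact: measurable_funM.
Qed.

Lemma mxmeasurableD m n (A B : T -> 'M[R]_(m, n)) :
  mxmeasurable A -> mxmeasurable B -> mxmeasurable (fun t => A t + B t).
Proof.
move=> mA mB i j; apply: eq_measurable_fun (measurable_funD (mA i j) (mB i j)).
by move=> t _; rewrite mxE.
Qed.

Lemma mxmeasurableB m n (A B : T -> 'M[R]_(m, n)) :
  mxmeasurable A -> mxmeasurable B -> mxmeasurable (fun t => A t - B t).
Proof.
move=> mA mB i j; apply: eq_measurable_fun (measurable_funB (mA i j) (mB i j)).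
by move=> t _; rewrite !mxE.
Qed.

Lemma measurable_mxtrace n (A : T -> 'M[R]_n) :
  mxmeasurable A -> measurable_fun D (fun t => \tr (A t)).
Proof. by move=> mA; apply: measurable_sum => k; exact: mA. Qed.

Lemma measurable_det n (A : T -> 'M[R]_n) :
  mxmeasurable A -> measurable_fun D (fun t => \det (A t)).
Proof.
move=> mA; apply: measurable_sum => s; apply: measurable_funM => //.
by apply: measurable_prod => i _; exact: mA.
Qed.

(** The power function is measurable on the whole line; the identity in the proof
    expresses the inverse with it, including at 0, whose inverse is 0. *)
Lemma measurable_invr (f : T -> R) :
  measurable_fun D f -> measurable_fun D (fun t => (f t)^-1).
Proof.
move=> mf; have fE t : (f t)^-1 = f t * (f t ^+ 2) `^ (-1).
  rewrite powR_inv1 ?sqr_ge0//.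
  by have [->|f0] := eqVneq (f t) 0; rewrite ?invr0 ?mul0r//; field.
under eq_fun do rewrite fE.
apply: measurable_funM => //.
by apply: (measurableT_comp (measurable_powR (-1))); exact: measurable_funX.
Qed.

Lemma measurable_sqrtr (f : T -> R) :
  measurable_fun D f -> measurable_fun D (fun t => Num.sqrt (f t)).
Proof.
move=> mf; have fE t : Num.sqrt (f t) = (Num.max (f t) 0) `^ 2^-1.
  rewrite powR12_sqrt ?le_max ?lexx ?orbT//.
  by case: (leP (f t) 0) => // f0; rewrite sqrtr0 ler0_sqrtr.
under eq_fun do rewrite fE.
apply: (measurableT_comp (measurable_powR 2^-1)).
exact: measurable_maxr.
Qed.

Lemma mxmeasurableV n (A : T -> 'M[R]_n) :
  mxmeasurable A -> mxmeasurable (fun t => invmx (A t)).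
Proof.
move=> mA i j.
apply: (eq_measurable_fun (fun t => if \det (A t) == 0 then A t i j else
    (\det (A t))^-1 * cofactor (A t) j i)).
  move=> t _; rewrite /invmx unitmxE unitfE; case: eqP => //= _.
  by rewrite !mxE.
apply: measurable_fun_if => //.
- by apply: measurable_fun_eqr => //; exact: measurable_det.
- by apply: measurable_funS (mA i j) => //; exact: subIset; left.
- apply: measurable_funS mD _ _; first by move=> t [].
  apply: measurable_funM; first by apply: measurable_invr; exact: measurable_det.
  apply: measurable_funM => //; apply: measurable_det => k l.
  by apply: eq_measurable_fun (mA (lift j k) (lift i l)) => t _; rewrite !mxE.
Qed.

End mxmeasurable.

(** * Continuous functions on open sets are Borel measurable *)

Section borel_continuous.

Lemma open_setI_preimage (M N : topologicalType) (A : set M) (f : M -> N) :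
  open A -> (forall x, A x -> {for x, continuous f}) ->
  forall U, open U -> open (A `&` f @^-1` U).
Proof.
move=> oA cf U oU; rewrite openE => x [Ax fUx].
apply: filterI; first exact: open_nbhs_nbhs.
by apply: (cf x Ax); exact: open_nbhs_nbhs.
Qed.

Lemma measurable_open (M : ptopologicalType) (U : set M) :
  open U -> measurable (U : set (borel M)).
Proof. exact: sub_sigma_algebra. Qed.

Lemma measurable_continuous (M N : ptopologicalType) (A : set M) (f : M -> N) :
  open A -> (forall x, A x -> {for x, continuous f}) ->
  measurable_fun (A : set (borel M)) (f : borel M -> borel N).
Proof.
move=> oA cf; apply: (@measurability _ _ (borel M) (borel N) A f (@open N)) => //.
by move=> _ [U oU <-]; apply: measurable_open; exact: open_setI_preimage.
Qed.

Lemma measurable_continuousR (R : realType) (M : ptopologicalType) (A : set M)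
    (f : M -> R) :
  open A -> (forall x, A x -> {for x, continuous f}) ->
  measurable_fun (A : set (borel M)) (f : borel M -> R).
Proof.
move=> oA cf.
apply: (@measurability _ _ (borel M) (measurableTypeR R) A f (@RGenOpens.G R)).
  exact: RGenOpens.measurableE.
by move=> _ [_ [a [b ->]] <-]; apply: measurable_open; apply: open_setI_preimage.
Qed.

End borel_continuous.

Lemma cvg_det (R : realType) (T : Type) (F : set_system T) (FF : Filter F) m
    (A : T -> 'M[R]_m) (L : 'M[R]_m) :
  (forall i j, A t i j @[t --> F] --> L i j) ->
  \det (A t) @[t --> F] --> \det L.
Proof.
move=> AL; apply: cvg_big => [|s _]; first exact: add_continuous.
apply: cvgM; first exact: cvg_cst.
by apply: cvg_big => [|i _]; [exact: mul_continuous|exact: AL].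
Qed.

(** * Measurability of the curvature norm *)

Section curvature_norm.
Variables (R : realType) (n r : nat) (M : ptopologicalType).
Variables (X : smooth_manifold R n M) (E : vector_bundle X r).
Variables (g : riemannian_metric X) (h : fibre_metric E).

Lemma codom_chart_open i : open (codom_chart X i).
Proof. exact: chart_open. Qed.

Lemma smooth_continuous (V : set 'rV[R]_n) (f : 'rV[R]_n -> R) :
  smooth V f -> forall y, V y -> {for y, continuous f}.
Proof. by move=> /(_ 0%N) []. Qed.

Lemma smooth_measurable (V : set 'rV[R]_n) (f : 'rV[R]_n -> R) : open V ->
  smooth V f ->
  measurable_fun (V : set (borel 'rV[R]_n)) (f : borel 'rV[R]_n -> R).
Proof. by move=> oV /smooth_continuous; exact: measurable_continuousR. Qed.

Lemma measurable_codom_chart i :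
  measurable (codom_chart X i : set (borel 'rV[R]_n)).
Proof. by apply: measurable_open; exact: codom_chart_open. Qed.

Lemma measurable_dom i : measurable (dom X i : set (borel M)).
Proof. by apply: measurable_open; exact: dom_open. Qed.

Lemma chart_continuous_at i x : dom X i x -> {for x, continuous (chart X i)}.
Proof.
have := @chart_continuous _ _ _ X i.
rewrite continuous_open_subspace; last exact: dom_open.
by move=> ci ix; apply: ci; rewrite inE.
Qed.

Lemma measurable_chart i :
  measurable_fun (dom X i : set (borel M))
    (chart X i : borel M -> borel 'rV[R]_n).
Proof.
apply: measurable_continuous; first exact: dom_open.
by move=> x; exact: chart_continuous_at.
Qed.

Lemma metric_sym_posdef i y : codom_chart X i y -> sym_posdef (metric g i y).
Proof.
move=> iy; split; first exact: Defs.metric_sym.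
by move=> u; exact: Defs.metric_pos.
Qed.

Lemma orthonormal_basisP i y : codom_chart X i y ->
  orthonormal_basis g i y *m metric g i y *m (orthonormal_basis g i y)^T = 1%:M.
Proof.
move=> /metric_sym_posdef /posdef_congr1 [P PE].
exact: (@xgetPex _ 1%:M [set P | P *m metric g i y *m P^T = 1%:M]
  (ex_intro _ P PE)).
Qed.

Lemma curv_coef_anti (D : connection E) i a b y :
  curv_coef D i b a y = - curv_coef D i a b y.
Proof. by rewrite /curv_coef opprB opprD opprB addrCA addrA. Qed.

Lemma hom_norm2E i y S :
  hom_norm2 h i y S = trform (invmx (gram h i y)) (gram h i y) S S.
Proof. by []. Qed.

(** The squared curvature norm, expressed without an orthonormal basis. *)
Definition curv_norm2 (D : connection E) i y : R :=
  2^-1 * \sum_(j : 'I_n * 'I_n) \sum_(k : 'I_n * 'I_n)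
    invmx (metric g i y) j.1 k.1 * invmx (metric g i y) j.2 k.2 *
    trform (invmx (gram h i y)) (gram h i y)
      (curv_coef D i j.1 j.2 y) (curv_coef D i k.1 k.2 y).

Lemma first_chartP x : dom X (first_chart X x) x /\
  forall j, dom X j x -> (first_chart X x <= j)%N.
Proof.
pose first i := dom X i x /\ forall j, dom X j x -> (i <= j)%N.
apply: (@xgetPex _ 0%N [set i | first i]).
have [i _ ix] : (\bigcup_i dom X i) x by rewrite dom_cover.
have ex : exists i, `[< dom X i x >] by exists i; apply/asboolP.
case: (ex_minnP ex) => m /asboolP mx mmin; exists m; split=> // j jx.
by apply: mmin; apply/asboolP.
Qed.

Lemma curv_normE (D : connection E) x :
  let i := first_chart X x in
  curv_norm g h D x = Num.sqrt (curv_norm2 D i (chart X i x)).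
Proof.
move=> i; rewrite /curv_norm -/i; congr Num.sqrt.
have iy : codom_chart X i (chart X i x).
  by exists x => //; have [] := first_chartP x.
rewrite /curv_norm2.
rewrite -(sum_orthonormal _ _ (orthonormal_basisP iy)
  (fun a b => curv_coef_anti D i a b (chart X i x))).
apply: eq_bigr => k _; apply: eq_bigr => l _; rewrite hom_norm2E.
by congr trform; apply: eq_bigr => a _; apply: eq_bigr => b _; rewrite !mxE.
Qed.

Section measurability.
Variables (q : R) (D : connection E).
Hypothesis DW : L1p E q D.

Let V i : set (borel 'rV[R]_n) := codom_chart X i.

Lemma mxmeasurable_form i a : mxmeasurable (V i) (Defs.form D i a).
Proof. by move=> s t; have [[]] := DW i a s t. Qed.

Lemma mxmeasurable_curv_coef i a b : mxmeasurable (V i) (curv_coef D i a b).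
Proof.
have md k l : mxmeasurable (V i) (fun y => \matrix_(s, t)
   weak_partial (codom_chart X i) k
     (fun z => Defs.form D i l z s t) y : 'M[R]_r).
  move=> s t; apply: (eq_measurable_fun (fun y : borel 'rV[R]_n =>
      weak_partial (codom_chart X i) k (fun z => Defs.form D i l z s t) y)).
    by move=> y _; rewrite mxE.
  have [_ /(_ k) [f wf _]] := DW i l s t.
  have [_ [] //] : is_weak_partial (codom_chart X i) k
    (fun z => Defs.form D i l z s t)
    (weak_partial (codom_chart X i) k (fun z => Defs.form D i l z s t)).
  by apply: xgetPex; exists f.
have mf := @mxmeasurable_form i.
have mV := measurable_codom_chart i.
by apply: mxmeasurableB; [apply: mxmeasurableD; [exact: mxmeasurableB|]|];
  try exact: mxmeasurableM.
Qed.

Lemma measurable_curv_norm2 i : measurable_fun (V i) (curv_norm2 D i).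
Proof.
have mV := measurable_codom_chart i.
have oV := @codom_chart_open i.
have mG : mxmeasurable (V i) (metric g i).
  by move=> a b; apply: smooth_measurable => //; exact: metric_smooth.
have mH : mxmeasurable (V i) (gram h i).
  move=> s t; apply: eq_measurable_fun (smooth_measurable oV (ip_smooth h i s t)).
  by move=> y _; rewrite mxE.
have mGi := mxmeasurableV mV mG.
have mHi := mxmeasurableV mV mH.
apply: measurable_funM => //; apply: measurable_sum => j; apply: measurable_sum => k.
apply: measurable_funM; first exact: measurable_funM.
apply: measurable_mxtrace; apply: mxmeasurableM; last exact: mxmeasurable_curv_coef.
apply: mxmeasurableM => //; apply: mxmeasurableM => //.
by apply: mxmeasurableT; exact: mxmeasurable_curv_coef.
Qed.

(** The manifold is the countable disjoint union of the Borel sets A i of the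
    points whose first chart has index i. *)
Lemma measurable_curv_norm :
  measurable_fun setT (curv_norm g h D : borel M -> R).
Proof.
pose A i : set (borel M) := dom X i `\` \bigcup_(j in `I_i) dom X j.
have mA i : measurable (A i).
  apply: measurableD; first exact: measurable_dom.
  by apply: bigcup_measurable => j _; exact: measurable_dom.
have AE i x : A i x -> first_chart X x = i.
  move=> [ix nx]; have [fx fmin] := first_chartP x.
  apply/eqP; rewrite eqn_leq fmin//= leqNgt; apply/negP => lt.
  by apply: nx; exists (first_chart X x).
have -> : setT = \bigcup_i A i.
  apply/seteqP; split=> // x _; have [fx fmin] := first_chartP x.
  exists (first_chart X x) => //; split => // -[j /= ji jx].
  by have := fmin _ jx; rewrite leqNgt ji.
apply/measurable_fun_bigcup => // i.
apply: (eq_measurable_fun (fun x : borel M =>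
    Num.sqrt (curv_norm2 D i (chart X i x)))).
  by move=> x; rewrite inE => /AE Ax; rewrite curv_normE Ax.
apply: measurable_sqrtr => //.
apply: (@measurable_comp _ _ _ _ _ _ (V i)) => //.
- exact: measurable_codom_chart.
- by move=> _ [x [ix _] <-]; exists x.
- exact: measurable_curv_norm2.
- apply: (@measurable_funS _ _ (borel M) _ (dom X i)); last exact: measurable_chart.
    exact: measurable_dom.
  by move=> x [].
Qed.

End measurability.

(** * Finiteness of the Riemannian volume *)

Section volume.
Variable vol : {measure set (borel M) -> \bar R}.
Hypothesis volP : is_riemannian_volume g vol.

Lemma lebesgue_ball_fin (y : 'rV[R]_n) e : 0 < e ->
  (lebesgue_rV R n (ball y e) < +oo)%E.
Proof.
move=> e0.
pose a : 'rV[R]_n := \row_j (y ord0 j - e).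
pose b : 'rV[R]_n := \row_j (y ord0 j + e).
have ab j : a ord0 j <= b ord0 j by rewrite !mxE lerD2l; lra.
apply: (@le_lt_trans _ _ (lebesgue_rV R n
    [set v : 'rV[R]_n | forall j, a ord0 j < v ord0 j <= b ord0 j])); last first.
  by rewrite lebesgue_rV_box// ltry.
apply: le_measure; rewrite ?inE.
- by apply: measurable_open; exact: ball_open.
- rewrite (_ : [set v | _] = \bigcap_(j in [set: 'I_n])
      ((fun v : borel 'rV[R]_n => v ord0 j : measurableTypeR R) @^-1`
         `]a ord0 j, b ord0 j]%classic)).
    apply: fin_bigcap_measurable => // j _; rewrite -[X in measurable X]setTI.
    exact: measurable_coord.
  apply/seteqP; split=> [v hv j _|v hv j].
    by rewrite /= in_itv; exact: hv.
  by have := hv j I; rewrite /= in_itv.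
- move=> v [_ yv] j; rewrite !mxE.
  by have := yv ord0 j; rewrite /ball/= ltr_norml; lra.
Qed.

Lemma volume_locally_finite x :
  exists U : set M, [/\ open U, U x & (vol U < +oo)%E].
Proof.
have [i _ ix] : (\bigcup_i dom X i) x by rewrite dom_cover.
pose y : 'rV[R]_n := chart X i x.
have iy : codom_chart X i y by exists x.
have detc : \det (metric g i z) @[z --> y] --> \det (metric g i y).
  apply: (@cvg_det _ _ _ (nbhs_filter y)) => a b.
  exact: (smooth_continuous (metric_smooth g i a b) iy).
have : \forall z \near y,
    codom_chart X i z /\ \det (metric g i z) < \det (metric g i y) + 1.
  apply: filterI.
    by apply: open_nbhs_nbhs; split=> //; exact: codom_chart_open.
  by apply: (cvgr_lt _ detc); rewrite ltrDl.
move=> /nbhs_ballP [e /= e0 eV].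
pose C := Num.sqrt (\det (metric g i y) + 1).
exists (dom X i `&` chart X i @^-1` ball y e); split.
- apply: open_setI_preimage; first exact: dom_open.
    by move=> z; exact: chart_continuous_at.
  exact: ball_open.
- by split=> //; exact: ballxx.
(* the ball lies in the codomain of the chart, so its preimage is sent onto it *)
have imE : chart X i @` (dom X i `&` chart X i @^-1` ball y e) = ball y e.
  apply/seteqP; split=> [_ [z [_ yz] <-]//|z yz].
  by have [[w iw wz] _] := eV z yz; exists w => //; split=> //=; rewrite wz.
rewrite (volP (i := i)); last by move=> z [].
  rewrite imE.
  have mB : measurable (ball y e : set (borel 'rV[R]_n)).
    by apply: measurable_open; exact: ball_open.
  apply: (@le_lt_trans _ _ (\int[lebesgue_rV R n]_(z in ball y e) (cst C%:E z))%E).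
    apply: ge0_le_integral => //.
    - apply/measurable_EFinP.
      apply: (@measurable_funS _ _ (borel 'rV[R]_n) _ (codom_chart X i)).
      + exact: measurable_codom_chart.
      + by move=> z /eV [].
      + apply: measurable_sqrtr.
        apply: measurable_det => a b.
        exact: smooth_measurable (@codom_chart_open i) (metric_smooth g i a b).
    - by move=> z /eV [_ /ltW zC]; rewrite lee_fin ler_wsqrtr.
  rewrite integral_cst// lte_mul_pinfty// ?lee_fin ?sqrtr_ge0//.
  exact: lebesgue_ball_fin.
apply: measurable_open; apply: open_setI_preimage; first exact: dom_open.
  by move=> z; exact: chart_continuous_at.
exact: ball_open.
Qed.

Lemma volume_fin : compact [set: M] -> (vol [set: M] < +oo)%E.
Proof.
rewrite compact_cover => cM.
pose U x := sval (cid (volume_locally_finite x)).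
have UP x : [/\ open (U x), U x x & (vol (U x) < +oo)%E].
  by rewrite /U; case: cid.
have [|x _|D _ MD] := cM M setT U; first by move=> x _; have [] := UP x.
  by exists x => //; have [] := UP x.
have Dfin := finite_fset D.
apply: (le_lt_trans (content_sub_fsum vol Dfin _ _ MD)) => //.
  by move=> x _; apply: measurable_open; have [] := UP x.
by rewrite fsbig_finite//; apply: lte_sum_pinfty => x _; have [] := UP x.
Qed.

End volume.
End curvature_norm.

(** * Minimizers *)

Lemma minimizerP (R : realType) (T : Type) (S : set T) (F : T -> \bar R)
    (D : T) :
  minimizer S F D <-> S D /\ forall D', S D' -> (F D <= F D')%E.
Proof.
split=> [[SD FD]|[SD FD]]; split=> //.
  by move=> D' SD'; rewrite FD; apply: ereal_inf_lbound; exists D'.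
apply/eqP; rewrite eq_le; apply/andP; split.
  by apply: le_ereal_inf_tmp => _ [D' SD' <-]; exact: FD.
by apply: ereal_inf_lbound; exists D.
Qed.

Section functionals.
Variables (R : realType) (n r : nat) (M : ptopologicalType).
Variables (X : smooth_manifold R n M) (E : vector_bundle X r).
Variables (g : riemannian_metric X) (h : fibre_metric E).
Variable vol : {measure set (borel M) -> \bar R}.
Variables (q : R) (D : connection E).
Hypothesis DW : L1p E q D.

Lemma curv_norm_ge0 x : 0 <= curv_norm g h D x.
Proof. exact: sqrtr_ge0. Qed.

Lemma YME : YM g h vol D =
  ((2^-1)%:E * \int[vol]_x (curv_norm g h D x ^+ 2)%:E)%E.
Proof.
rewrite -ge0_integralZl_EFin//.
- by move=> x _; rewrite lee_fin sqr_ge0.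
- by apply/measurable_EFinP; apply: measurable_funX; exact: measurable_curv_norm DW.
Qed.

Lemma YMpE p : 0 <= p -> YMp g h vol p D =
  ((p^-1)%:E * \int[vol]_x (curv_norm g h D x `^ p)%:E)%E.
Proof.
move=> p0; rewrite -ge0_integralZl_EFin ?invr_ge0//.
- by move=> x _; rewrite lee_fin powR_ge0.
- apply/measurable_EFinP; apply: (measurableT_comp (measurable_powR p)).
  exact: measurable_curv_norm DW.
Qed.

Lemma integral_curv_norm_cst c (phi : R -> R) : measurable_fun setT phi ->
  {ae vol, forall x, curv_norm g h D x = c} ->
  (\int[vol]_x (phi (curv_norm g h D x))%:E = (phi c)%:E * vol setT)%E.
Proof.
move=> mphi Dc; rewrite -integral_cst//; apply: ae_eq_integral => //.
- apply/measurable_EFinP; apply: (measurableT_comp mphi).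
  exact: measurable_curv_norm DW.
- case: Dc => N [mN N0 hN]; exists N; split=> // x hx; apply: hN => /= e.
  by apply: hx => _ /=; rewrite e.
Qed.

End functionals.

(* For p = 2 the two functionals coincide, and on the round 4-sphere the
   conformal pullbacks of the standard instanton are minimizers with
   non-constant norm: the last assertion needs p <> 2. *)
Theorem theorem10p2 (R : realType) (n r : nat) (M : ptopologicalType)
    (X : smooth_manifold R n M) (g : riemannian_metric X)
    (vol : {measure set (borel M) -> \bar R})
    (E : vector_bundle X r) (h : fibre_metric E) (p : R) (D : connection E) :
  compact [set: M] ->
  is_riemannian_volume g vol ->
  2 <= p ->
  minimizer (Wp E p) (YM g h vol) D ->
  curv_norm_ae_constant g h vol D ->
  minimizer (Wp E p) (YMp g h vol p) D /\
  (2 < p ->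
   forall D' : connection E, minimizer (Wp E p) (YMp g h vol p) D' ->
     curv_norm_ae_constant g h vol D').
Proof.
move=> cM volP p2 /minimizerP[DW Dmin] [c Dc].
have p0 : 0 < p by lra.
have volfin := volume_fin volP cM.
have mnorm (D' : connection E) : Wp E p D' ->
    measurable_fun setT (curv_norm g h D' : borel M -> R).
  by move=> [_ D'2]; exact: measurable_curv_norm D'2.
(* on a manifold of volume zero the sign of c is arbitrary *)
pose c' := `|c|.
have Dc' : {ae vol, forall x, curv_norm g h D x = c'}.
  case: Dc => N [mN N0 hN]; exists N; split=> // x hx; apply: hN => /= e.
  by apply: hx; rewrite /c' -e ger0_norm// curv_norm_ge0.
have YMmin (D' : connection E) : Wp E p D' ->
    ((c' ^+ 2)%:E * vol setT <= \int[vol]_x (curv_norm g h D' x ^+ 2)%:E)%E.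
  move=> D'W; have := Dmin _ D'W.
  rewrite (YME _ _ _ DW.2) (YME _ _ _ D'W.2) lee_pmul2l ?lte_fin//.
  by rewrite (integral_curv_norm_cst DW.2 (phi := fun t => t ^+ 2) _ Dc').
have YMpD : YMp g h vol p D = ((p^-1)%:E * ((c' `^ p)%:E * vol setT))%E.
  rewrite (YMpE _ _ _ DW.2 (ltW p0)).
  by rewrite (integral_curv_norm_cst DW.2 (measurable_powR p) Dc').
split=> [|p2' D' /minimizerP[D'W D'min]].
  apply/minimizerP; split; first exact: DW.
  move=> D' D'W.
  rewrite YMpD (YMpE _ _ _ D'W.2 (ltW p0)) lee_pmul2l// ?lte_fin ?invr_gt0//.
  apply: (integral_powR_ge (c := c')) => //.
  - exact: mnorm.
  - by move=> x; exact: curv_norm_ge0.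
  - exact: normr_ge0.
  - exact: YMmin.
exists c'; apply: (integral_powR_eq (p := p)) => //.
- exact: mnorm.
- by move=> x; exact: curv_norm_ge0.
- exact: normr_ge0.
- exact: YMmin.
- have := D'min _ DW.
  by rewrite YMpD (YMpE _ _ _ D'W.2 (ltW p0)) lee_pmul2l ?lte_fin ?invr_gt0.
Qed.
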